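(* Let $(X_0,X_1)$ be a compatible couple. If $a\in SV(0,\infty)\cap AC(0,\infty)$ satisfies $$a\ \text{is strictly decreasing},\quad a(0)=\infty,\quad a(\infty)>0,$$ then $X_0\cap X_1$ is dense in $(X_0,X_1)_{0,1,a;J}$.
   Context: A pair $(X_0,X_1)$ of Banach spaces is a compatible couple if there is a Hausdorff topological vector space in which both $X_0$ and $X_1$ are continuously embedded. $X_0\cap X_1$ carries the norm $\max\{\|f\|_{X_0},\|f\|_{X_1}\}$ and $X_0+X_1$ the norm $\inf\{\|f_0\|_{X_0}+\|f_1\|_{X_1}: f=f_0+f_1\}$. For $f\in X_0\cap X_1$ and $t>0$, $J(f,t;X_0,X_1):=\max\{\|f\|_{X_0},t\|f\|_{X_1}\}$. $(X_0,X_1)_{0,1,a;J}$ is the set of $f\in X_0+X_1$ for which there is a strongly measurable $u:(0,\infty)\to X_0\cap X_1$ with $f=\int_0^\infty u(s)\,\frac{ds}{s}$ (convergence in $X_0+X_1$) and for which $\|f\|_{0,1,a;J}:=\inf\|t^{-1}a(t)J(u(t),t;X_0,X_1)\|_{1,(0,\infty)}$ is finite, the infimum being over all such representations of $f$; here $\|\cdot\|_{1,(0,\infty)}$ is the $L_1$-norm on $(0,\infty)$. Density is with respect to $\|\cdot\|_{0,1,a;J}$. $SV(0,\infty)$ is the set of slowly varying functions: positive, finite, Lebesgue-measurable functions $b$ on $(0,\infty)$ such that for each $\varepsilon>0$, $t^{\varepsilon}b(t)$ is equivalent to a non-decreasing function on $(0,\infty)$ and $t^{-\varepsilon}b(t)$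 is equivalent to a non-increasing function on $(0,\infty)$ (two non-negative functions are equivalent if each is bounded by a positive constant multiple of the other). $AC(0,\infty)$ is the set of functions that are absolutely continuous on every compact subinterval of $(0,\infty)$. For monotone $f$ on $(0,\infty)$, $f(0):=\lim_{t\to0+}f(t)$ and $f(\infty):=\lim_{t\to\infty}f(t)$. *)

(* Defs.v *)
From HB Require Import structures.
From mathcomp Require Import all_boot all_order all_algebra.
From mathcomp Require Import all_classical all_reals all_analysis.

Set Implicit Arguments.
Unset Strict Implicit.
Unset Printing Implicit Defensive.

Import Order.TTheory GRing.Theory Num.Theory.
Import numFieldNormedType.Exports.

Local Open Scope classical_set_scope.
Local Open Scope ring_scope.

Definition halfline (R : realType) : set R := `]0, +oo[.
Arguments halfline R : clear implicits.

(* The real line with the sigma-algebra of Lebesgue-measurable sets; the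
   default measurable structure on R is the Borel one. *)
Notation lebesgueR R := (caratheodory_type (@wlength R idfun)^*%mu).

Definition leb (R : realType) : {measure set (lebesgueR R) -> \bar R} :=
  @completed_lebesgue_measure R.

Definition leb_measurable_fun (R : realType) (b : R -> R) : Prop :=
  measurable_fun (halfline R : set (lebesgueR R))
                 (b : lebesgueR R -> measurableTypeR R).

Section functions_on_halfline.
Variable R : realType.
Implicit Types f g a b : R -> R.

Definition equiv_fun f g : Prop :=
  (exists2 c, 0 < c & forall t, 0 < t -> f t <= c * g t) /\
  (exists2 c, 0 < c & forall t, 0 < t -> g t <= c * f t).

Definition nonneg_fun f : Prop := forall t, 0 < t -> 0 <= f t.
Definition nondecreasing_halfline f : Prop :=
  forall s t, 0 < s -> s <= t -> f s <= f t.
Definition nonincreasing_halfline f : Prop :=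
  forall s t, 0 < s -> s <= t -> f t <= f s.
Definition decreasing_halfline f : Prop :=
  forall s t, 0 < s -> s < t -> f t < f s.

Definition slowly_varying b : Prop :=
  [/\ forall t, 0 < t -> 0 < b t,
      leb_measurable_fun b &
      forall eps : R, 0 < eps ->
        (exists g, [/\ nonneg_fun g, nondecreasing_halfline g &
           equiv_fun (fun t => t `^ eps * b t) g]) /\
        (exists g, [/\ nonneg_fun g, nonincreasing_halfline g &
           equiv_fun (fun t => t `^ (- eps) * b t) g])].

Definition abs_continuous_itv (c d : R) f : Prop :=
  forall eps : R, 0 < eps -> exists2 delta : R, 0 < delta &
    forall (n : nat) (I : 'I_n -> R * R),
      (forall i, [/\ c <= (I i).1, (I i).1 <= (I i).2 & (I i).2 <= d]) ->
      trivIset setT (fun i => `](I i).1, (I i).2[%classic) ->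
      \sum_(i < n) ((I i).2 - (I i).1) < delta ->
      \sum_(i < n) `|f (I i).2 - f (I i).1| < eps.

Definition abs_continuous_halfline f : Prop :=
  forall c d : R, 0 < c -> c <= d -> abs_continuous_itv c d f.

Definition L1norm (g : R -> \bar R) : \bar R :=
  (\int[@leb R]_(t in halfline R) `|g t|)%E.

End functions_on_halfline.

(* A normed space continuously contained in Z is encoded by an extended norm
   N : Z -> \bar R: its elements are the z with N z < +oo, and N is its norm. *)
Section vector_valued_integration.
Variables (R : realType) (Z : lmodType R) (N : Z -> \bar R).
Implicit Types (phi : {fimfun R >-> Z}) (v : R -> Z).

Definition simple_fun phi : Prop :=
  (forall t, 0 < t -> (N (phi t) < +oo)%E) /\
  (forall z : Z,
     measurable (halfline R `&` phi @^-1` [set z] : set (lebesgueR R))).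

Definition integrable_simple_fun phi : Prop :=
  simple_fun phi /\
  (forall z : Z, z != 0 -> (leb R (halfline R `&` phi @^-1` [set z]) < +oo)%E).

(* The value z = 0 may be taken on a set of infinite measure; its term is 0. *)
Definition simple_integral phi : Z :=
  \sum_(z \in range phi) fine (leb R (halfline R `&` phi @^-1` [set z])) *: z.

Definition strongly_measurable v : Prop :=
  exists phi_ : nat -> {fimfun R >-> Z},
    (forall n, simple_fun (phi_ n)) /\
    {ae leb R, forall t : lebesgueR R, halfline R t ->
       (fun n => N (v t - phi_ n t)) @ \oo --> (0 : \bar R)%E}.

(* f is the Bochner integral of v over the half-line, in the normed space
   given by N. *)
Definition is_bochner_integral v (f : Z) : Prop :=
  strongly_measurable v /\
  exists phi_ : nat -> {fimfun R >-> Z},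
    [/\ forall n, integrable_simple_fun (phi_ n),
        (fun n => L1norm (fun t => N (v t - phi_ n t))) @ \oo
          --> (0 : \bar R)%E &
        (fun n => N (f - simple_integral (phi_ n))) @ \oo --> (0 : \bar R)%E].

End vector_valued_integration.

(* Scalars are real. The notions below depend only on the underlying real
   spaces, so a complex couple is covered by restriction of scalars. *)
Section couple.
Variables (R : realType) (X0 X1 : completeNormedModType R).
Variables (Z : topologicalLmodType R).
Variables (i0 : {linear X0 -> Z}) (i1 : {linear X1 -> Z}).
Local Open Scope ereal_scope.

Definition compatible_couple : Prop :=
  [/\ hausdorff_space Z,
      injective i0 /\ continuous i0 &
      injective i1 /\ continuous i1].

(* For an embedding i this is the norm of X transported to i(X) and +oo
   outside i(X), the infimum being over at most one point. *)
Definition embedded_norm (X : completeNormedModType R) (i : {linear X -> Z})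
  (z : Z) : \bar R := ereal_inf [set `|x|%:E | x in [set x | i x = z]].

Definition couple_cap : set Z := range i0 `&` range i1.

Definition couple_sum : set Z := [set f | exists x0 x1, f = (i0 x0 + i1 x1)%R].

Definition cap_norm (f : Z) : \bar R :=
  maxe (embedded_norm i0 f) (embedded_norm i1 f).

Definition sum_norm (f : Z) : \bar R :=
  ereal_inf [set r | exists f0 f1, f = (f0 + f1)%R /\
                     r = embedded_norm i0 f0 + embedded_norm i1 f1].

Definition J_functional (f : Z) (t : R) : \bar R :=
  maxe (embedded_norm i0 f) (t%:E * embedded_norm i1 f).

Definition J_representation (f : Z) (u : R -> Z) : Prop :=
  [/\ forall t : R, (0 < t)%R -> couple_cap (u t),
      strongly_measurable cap_norm u &
      is_bochner_integral sum_norm (fun s => (s^-1 *: u s)%R) f].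

Definition J_norm (a : R -> R) (f : Z) : \bar R :=
  ereal_inf [set L1norm (fun t => (t^-1 * a t)%:E * J_functional (u t) t)
            | u in [set u | J_representation f u]].

(* (X0, X1)_{0,1,a;J} *)
Definition J_space (a : R -> R) : set Z :=
  [set f | [/\ couple_sum f, exists u, J_representation f u &
               J_norm a f < +oo]].

Definition dense_in_J_space (a : R -> R) (A : set Z) : Prop :=
  A `<=` J_space a /\
  forall f, J_space a f -> forall eps : R, (0 < eps)%R ->
    exists2 g, A g & J_norm a (f - g)%R < eps%:E.

End couple.

(* Main.v *)
Require Import Defs.
From HB Require Import structures.
From mathcomp Require Import all_boot all_order all_algebra.
From mathcomp Require Import all_classical all_reals all_analysis.
From mathcomp Require Import measurable_realfun.

Set Implicit Arguments.
Unset Strict Implicit.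
Unset Printing Implicit Defensive.

Import Order.TTheory GRing.Theory Num.Theory.
Import numFieldNormedType.Exports.

Local Open Scope classical_set_scope.
Local Open Scope ring_scope.

(** Why the theorem is true.  Let f be represented by u, and put
    w t := t^-1 u t, so that f is the Bochner integral of w for Lebesgue
    measure and the weighted norm of u is the integral of a t * J (w t, t).
    If psi is a simple function with values in the intersection and support
    of finite measure, then g := simple_integral psi is a finite linear
    combination of elements of the intersection, hence belongs to it; and
    u t - t psi t represents f - g.  So the norm of f - g is at most the
    integral of a t * J (w t - psi t, t), and it suffices to make this
    integral small.  The point of approximating by simple functions, rather
    than truncating u to a compact interval, is that g is then visibly in the
    intersection, without a Bochner integral having to be constructed there.

    The approximation is simple_fun_dense.  Strong measurability gives simple
    functions phi_k with w - phi_k tending to 0 almost everywhere in the norm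
    of the intersection, hence in each norm J (., t).  Let psi_k be phi_k at
    the points t <= k+1 where phi_k is at least as good an approximation of w
    as 0 is, and 0 elsewhere.  Then a t * J (w - psi_k, t) is dominated by
    a t * J (w, t), which is integrable, and still tends to 0 almost
    everywhere, so dominated convergence applies.  The norms of the
    intersection and of the sum, and the weighted functionals a t * J (., t),
    are all extended seminorms, and this argument is carried out for a
    measurable family of extended seminorms dominated by a fixed one.

    That the intersection is contained in the J-space is the other half of
    density (couple_cap_sub_J_space).  An element g of the intersection is the
    simple integral of the function with value g on [1, 2[ and 0 elsewhere,
    and the weighted norm of that representation is finite because a is
    bounded by a 1 on [1, 2[. *)

(** * Extended seminorms *)

Section ext_seminorm.
Context {R : realType} {Z : lmodType R}.
Local Open Scope ereal_scope.

(** The homogeneity axiom is an inequality only, which is easier to check; for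
    nonzero scalars it implies the equality esnZ. *)
Record ext_seminorm (N : Z -> \bar R) : Prop := ExtSeminorm {
  esn_ge0 : forall z, 0 <= N z;
  esn_leD : forall x y, N (x + y)%R <= N x + N y;
  esn_leZ : forall (c : R) z, N (c *: z)%R <= `|c|%:E * N z }.

Variable N : Z -> \bar R.
Hypothesis hN : ext_seminorm N.

Lemma esn0 : N 0%R = 0.
Proof.
apply/eqP; rewrite eq_le (esn_ge0 hN) andbT.
by have := esn_leZ hN 0%R 0%R; rewrite scale0r normr0 mul0e.
Qed.

Lemma esn_leB x y : N (x - y)%R <= N x + N y.
Proof.
apply: (le_trans (esn_leD hN _ _)); rewrite leeD2l// -scaleN1r.
by apply: (le_trans (esn_leZ hN _ _)); rewrite normrN1 mul1e.
Qed.

Lemma esnZ c z : c != 0%R -> N (c *: z)%R = `|c|%:E * N z.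
Proof.
move=> c0; apply/eqP; rewrite eq_le (esn_leZ hN)/=.
rewrite -[in leLHS](scalerK c0 z).
apply: (le_trans (lee_wpmul2l _ (esn_leZ hN _ _))); first by rewrite lee_fin.
by rewrite muleA -EFinM normfV mulfV ?normr_eq0// mul1e.
Qed.

(** The reverse triangle inequality, which needs N x finite to make sense. *)
Lemma esn_cvg (y : nat -> Z) x : N x < +oo ->
  N (x - y n)%R @[n --> \oo] --> 0 -> N (y n) @[n --> \oo] --> N x.
Proof.
move=> Nx xy.
have Nxf : N x \is a fin_num by rewrite ge0_fin_numE ?(esn_ge0 hN).
have h1 : N x - N (x - y n)%R @[n --> \oo] --> N x.
  rewrite -[X in _ --> X]sube0; apply: cvgeB => //.
    by rewrite fin_num_adde_defl// fin_numN.
  exact: cvg_cst.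
have h2 : N x + N (x - y n)%R @[n --> \oo] --> N x.
  rewrite -[X in _ --> X]adde0; apply: cvgeD => //.
    by rewrite fin_num_adde_defl.
  exact: cvg_cst.
apply: (squeeze_cvge _ h1 h2); near=> n.
have fn : N (x - y n)%R \is a fin_num.
  near: n; have := xy; move/fine_cvgP => [+ _]; exact.
apply/andP; split.
  rewrite leeBlDr//; apply: le_trans (esn_leD hN _ _).
  by rewrite [X in _ <= N X](_ : _ = x)// addrC subrK.
rewrite [X in N X](_ : _ = x - (x - y n))%R; first exact: esn_leB.
by rewrite opprB addrC subrK.
Unshelve. all: by end_near. Qed.

End ext_seminorm.

(** * Functions with finitely many measurable level sets *)

Section levels.
Context {R : realType}.
Notation D := (halfline R : set (lebesgueR R)).

Lemma halflineP (t : R) : halfline R t <-> 0 < t.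
Proof. by rewrite /halfline /= in_itv/= andbT. Qed.

Lemma borel_lebesgue_measurable (A : set R) :
  measurable (A : set (measurableTypeR R)) ->
  measurable (A : set (lebesgueR R)).
Proof. exact: sub_caratheodory. Qed.

Lemma measurable_halfline : measurable D.
Proof. by apply: borel_lebesgue_measurable; exact: measurable_itv. Qed.

Lemma measurable_fun_borel_lebesgue (f : R -> R) :
  measurable_fun setT (f : measurableTypeR R -> measurableTypeR R) ->
  measurable_fun D (EFin \o f : lebesgueR R -> \bar R).
Proof.
move=> mf; apply/measurable_EFinP => mD Y mY; apply: measurableI => //.
by apply: borel_lebesgue_measurable; rewrite -[_ @^-1` _]setTI; exact: mf.
Qed.

(** The part of simplicity that refers to no norm, so that it also makes sense
    for scalar or boolean valued functions; only the points of the half-line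
    matter for measurability, while the range is that of the whole function. *)
Definition simple_levels (T : Type) (g : R -> T) : Prop :=
  finite_set (range g) /\
  forall z, measurable (halfline R `&` g @^-1` [set z] : set (lebesgueR R)).

Lemma measurable_levels_preimage (T : Type) (g : R -> T) (A : set T) :
  simple_levels g -> measurable (D `&` g @^-1` A : set (lebesgueR R)).
Proof.
move=> [gfin gm].
rewrite (_ : _ `&` _ =
    \bigcup_(z in range g `&` A) (D `&` g @^-1` [set z])).
  by apply: fin_bigcup_measurable => // ; exact: finite_setIl.
apply/seteqP; split => [t [Dt At]|t [z [_ Az] [Dt gt]]].
  by exists (g t) => //; split => //; exists t.
by split => //; rewrite /preimage/= gt.
Qed.

Lemma simple_levels2 (T1 T2 T : Type) (g : R -> T1) (h : R -> T2)
    (F : T1 -> T2 -> T) :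
  simple_levels g -> simple_levels h -> simple_levels (fun t => F (g t) (h t)).
Proof.
move=> lg lh; split.
  apply: (@sub_finite_set _ _ ((fun p => F p.1 p.2) @` (range g `*` range h))).
    by move=> _ [t _ <-]; exists (g t, h t) => //; split; exists t.
  by apply: finite_image; apply: finite_setX; [case: lg|case: lh].
move=> z; rewrite (_ : _ `&` _ = \bigcup_(x in range g)
   ((D `&` g @^-1` [set x]) `&` (D `&` h @^-1` [set y | F x y = z]))).
  apply: fin_bigcup_measurable => [|x _]; first by case: lg.
  by apply: measurableI; exact: measurable_levels_preimage.
apply/seteqP; split => [t [Dt Ft]|t [x _ [[Dt gx] [_ hx]]]].
  by exists (g t); [exists t|].
by split => //; rewrite /preimage/= gx.
Qed.

Lemma simple_levels_bool (b : R -> bool) :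
  measurable (D `&` [set t | b t] : set (lebesgueR R)) -> simple_levels b.
Proof.
move=> mb; split; first exact: finite_finset.
case; first exact: mb.
rewrite (_ : _ `&` _ = D `\` (D `&` [set t | b t])).
  by apply: measurableD => //; exact: measurable_halfline.
apply/seteqP; split => t /=; rewrite /preimage/=.
  by move=> [Dt bt]; split => // -[_]; rewrite bt.
by move=> [Dt nb]; split => //; apply/negbTE/negP => bt; apply: nb.
Qed.

(** A family G of measurable functions can be evaluated along a simple
    selection of its index: this only glues finitely many of them along
    measurable pieces. *)
Lemma measurable_fun_levels (T : Type) (g : R -> T)
    (G : T -> lebesgueR R -> \bar R) :
  simple_levels g -> (forall z, measurable_fun D (G z)) ->
  measurable_fun D (fun t => G (g t) t).
Proof.
move=> lg mG _ Y mY.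
rewrite (_ : _ `&` _ = \bigcup_(z in range g)
   ((D `&` g @^-1` [set z]) `&` (D `&` G z @^-1` Y))).
  apply: fin_bigcup_measurable => [|z _]; first by case: lg.
  apply: measurableI; first by case: lg.
  by apply: mG => //; exact: measurable_halfline.
apply/seteqP; split => [t [Dt Gt]|t [z _ [[Dt gz] [_ hz]]]].
  by exists (g t); [exists t|].
by split => //; rewrite /preimage/= gz.
Qed.

Lemma fimfun_of (T : Type) (f : R -> T) : finite_set (range f) ->
  exists phi : {fimfun R >-> T}, (phi : R -> T) = f.
Proof. by move=> /mem_set h; exists (fimfun_Sub h). Qed.

End levels.

(** * The integral of simple functions *)

Section simple_integral_theory.
Context {R : realType} {Z : lmodType R}.

(** The integral may be computed over any finer measurable partition, such as
    the common refinement of two simple functions; grouping the pieces on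
    which F takes a given value recovers the level sets of phi. Pieces of
    infinite measure are harmless because F vanishes there. *)
Lemma simple_integral_comp (T : choiceType) (g : R -> T) (F : T -> Z)
    (phi : {fimfun R >-> Z}) :
  simple_levels g -> (forall t, phi t = F (g t)) ->
  (forall p, F p != 0 -> (leb R (halfline R `&` g @^-1` [set p]) < +oo)%E) ->
  simple_integral phi =
  \sum_(p \in range g) fine (leb R (halfline R `&` g @^-1` [set p])) *: F p.
Proof.
move=> [gfin gm] phiE mfin; rewrite /simple_integral.
pose m p := fine (leb R (halfline R `&` g @^-1` [set p])) *: F p.
have fibre z :
    fine (leb R (halfline R `&` phi @^-1` [set z])) *: z =
    \sum_(p \in range g) (if p \in [set p | F p = z] then m p else 0).
  have [->|z0] := eqVneq z 0.
    rewrite scaler0 fsbig1// => p _; case: ifPn => //.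
    by rewrite inE /m /= => ->; rewrite scaler0.
  rewrite (_ : _ `&` _ = \bigcup_(p in range g `&` [set p | F p = z])
      (halfline R `&` g @^-1` [set p])); last first.
    apply/seteqP; split => [t [Dt pt]|t [p [_ Fp] [Dt gt]]].
      by exists (g t) => //; split; [exists t|rewrite /= -phiE].
    by split => //; rewrite /preimage/= phiE gt.
  have Ifin : finite_set (range g `&` [set p | F p = z]) by exact: finite_setIl.
  rewrite measure_fin_bigcup//; last first.
    by move=> p q _ _ [t [[_ <-] [_ <-]]].
  rewrite -fsbig_mkcondr !fsbig_finite//= big_seq -sum_fine; last first.
    move=> p; rewrite in_fset_set// => /set_mem[_ Fp].
    by rewrite ge0_fin_numE// mfin// Fp.
  rewrite scaler_suml [RHS]big_seq; apply: eq_bigr => p.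
  by rewrite in_fset_set// => /set_mem[_ Fp]; rewrite /m Fp.
(* Each piece p belongs to exactly one level set, that of the value F p. *)
rewrite (eq_fsbigr _ _ (in1W fibre)) exchange_fsbig//.
apply: eq_fsbigr => p /set_mem [t _ gt].
rewrite (eq_fsbigr (fun z => if z \in [set F p] then m p else 0)).
  rewrite -fsbig_mkcondr (_ : _ `&` _ = [set F p]) ?fsbig_set1//.
  apply/seteqP; split => [z []//|_ ->]; split => //.
  by exists t; rewrite ?phiE ?gt.
move=> z _; congr (if _ then _ else _).
by apply/idP/idP; rewrite !inE.
Qed.

(** All three integrals are computed on the partition by the level sets of the
    pair (phi, psi), where they are sums of the same shape. *)
Lemma simple_integralB (N N' : Z -> \bar R) (phi psi theta : {fimfun R >-> Z}) :
  integrable_simple_fun N phi -> integrable_simple_fun N' psi ->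
  (forall t, theta t = phi t - psi t) ->
  simple_integral theta = simple_integral phi - simple_integral psi.
Proof.
move=> [[_ mphi] iphi] [[_ mpsi] ipsi] thE.
pose g t := (phi t, psi t).
have lg : simple_levels g by exact: (@simple_levels2 _ _ _ _ phi psi).
have gle p (A : set R) : measurable (halfline R `&` A : set (lebesgueR R)) ->
    (leb R (halfline R `&` A) < +oo)%E -> g @^-1` [set p] `<=` A ->
    (leb R (halfline R `&` g @^-1` [set p]) < +oo)%E.
  move=> mA fA gA; apply: le_lt_trans fA.
  rewrite le_measure ?inE//; first by case: lg.
  by apply: setIS.
have fphi p : p.1 != 0 -> (leb R (halfline R `&` g @^-1` [set p]) < +oo)%E.
  by move=> p0; apply: (gle p _ (mphi p.1) (iphi _ p0)) => t /= <-.
have fpsi p : p.2 != 0 -> (leb R (halfline R `&` g @^-1` [set p]) < +oo)%E.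
  by move=> p0; apply: (gle p _ (mpsi p.2) (ipsi _ p0)) => t /= <-.
rewrite (@simple_integral_comp _ g fst phi)//.
rewrite (@simple_integral_comp _ g snd psi)//.
rewrite (@simple_integral_comp _ g (fun p => p.1 - p.2) theta)//.
  have gf : finite_set (range g) by case: lg.
  rewrite !fsbig_finite//= -sumrB; apply: eq_bigr => p _.
  by rewrite scalerBr.
move=> p; have [->|/fphi//] := eqVneq p.1 0.
by rewrite sub0r oppr_eq0 => /fpsi.
Qed.

Lemma simple_integral_indic (A : set R) (z : Z) (phi : {fimfun R >-> Z}) :
  measurable (A : set (lebesgueR R)) -> A `<=` halfline R ->
  (leb R A < +oo)%E ->
  (forall t, phi t = if t \in A then z else 0) ->
  simple_integral phi = fine (leb R A) *: z.
Proof.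
move=> mA AD fA phiE.
pose b t := t \in A; have lb : simple_levels b.
  apply: simple_levels_bool; rewrite set_mem_set.
  by apply: measurableI => //; exact: measurable_halfline.
have bE : halfline R `&` b @^-1` [set true] = A.
  apply/seteqP; split => [t [_ /set_mem//]|t At]; split; first exact: AD.
  by rewrite /preimage /b/= mem_set.
rewrite (@simple_integral_comp _ b (fun c : bool => if c then z else 0))//;
  last first.
  by case=> [_|]; rewrite ?eqxx// bE.
(* The value true is missed by b when A is empty; its term is then 0. *)
rewrite (fsbig_widen (range b) setT)//=; last first.
  case=> -[_ nb]; rewrite /= ?scaler0// bE.
  rewrite (_ : A = set0) ?measure0 ?scale0r//.
  apply/seteqP; split => // t At; apply: nb; exists t => //.
  by rewrite /b mem_set.
rewrite -(fsbig_widen [set true] setT)//=; first by rewrite fsbig_set1 bE.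
by case=> -[_ nb]; rewrite /= ?scaler0//; case: nb.
Qed.

End simple_integral_theory.

(** * Strong measurability and approximation by simple functions *)

Section strong_measurability.
Import HBSimple.
Context {R : realType} {Z : lmodType R}.
Notation D := (halfline R : set (lebesgueR R)).
Local Open Scope ereal_scope.

Lemma simple_fun_levels (N : Z -> \bar R) (phi : {fimfun R >-> Z}) :
  simple_fun N phi -> simple_levels phi.
Proof. by move=> [_ mphi]; split. Qed.

Lemma simple_fun_of (N : Z -> \bar R) (g : R -> Z) :
  simple_levels g -> (forall t, (0 < t)%R -> N (g t) < +oo) ->
  exists2 phi : {fimfun R >-> Z}, (phi : R -> Z) = g & simple_fun N phi.
Proof.
move=> [gf gm] gN; have [phi phig] := fimfun_of gf.
by exists phi => //; split => [t t0|z]; rewrite phig//; exact: gN.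
Qed.

Lemma strongly_measurable_simple (N : Z -> \bar R) (phi : {fimfun R >-> Z}) :
  ext_seminorm N -> simple_fun N phi -> strongly_measurable N phi.
Proof.
move=> hN sphi; exists (fun=> phi); split => //.
apply: aeW => t _; under eq_fun do rewrite subrr (esn0 hN).
exact: cvg_cst.
Qed.

Lemma strongly_measurableB (N : Z -> \bar R) (v w : R -> Z) :
  ext_seminorm N -> strongly_measurable N v -> strongly_measurable N w ->
  strongly_measurable N (fun t => v t - w t)%R.
Proof.
move=> hN [phi [sphi vphi]] [psi [spsi wpsi]].
have th n : exists th : {fimfun R >-> Z},
    (th : R -> Z) = (fun t => phi n t - psi n t)%R /\ simple_fun N th.
  have [||th thE sth] := @simple_fun_of N (fun t => phi n t - psi n t)%R.
  - apply: (@simple_levels2 _ _ _ _ (phi n) (psi n) (fun x y => x - y)%R).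
      exact: simple_fun_levels (sphi n).
    exact: simple_fun_levels (spsi n).
  - move=> t t0; apply: (le_lt_trans (esn_leB hN _ _)).
    by rewrite lte_add_pinfty//; [apply (sphi n)|apply (spsi n)].
  by exists th.
have [theta thetaE] := choice th.
exists theta; split => [n|]; first by have [] := thetaE n.
apply: filterS2 vphi wpsi => t vt wt Dt.
have vw : N (v t - phi n t)%R + N (w t - psi n t)%R @[n --> \oo] --> 0.
  by rewrite -[X in _ --> X]adde0; apply: cvgeD => //; [exact: vt|exact: wt].
apply: (squeeze_cvge _ (cvg_cst 0) vw).
apply: nearW => n; rewrite (esn_ge0 hN)/= (proj1 (thetaE n)).
rewrite [X in N X](_ : _ = (v t - phi n t) - (w t - psi n t))%R ?esn_leB//.
by rewrite !opprB addrACA [RHS]addrACA [in LHS](addrC (- w t))%R.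
Qed.

(** With simple g_n tending to h, the products g_n phi_n approximate h w since
    h w - g_n phi_n = h (w - phi_n) + (h - g_n) phi_n, where N (phi_n) stays
    bounded because it tends to the finite value N (w). *)
Lemma strongly_measurableZ (N : Z -> \bar R) (h : lebesgueR R -> R)
    (w : R -> Z) :
  ext_seminorm N -> measurable_fun D (EFin \o h) ->
  (forall t, (0 < t)%R -> N (w t) < +oo) ->
  strongly_measurable N w ->
  strongly_measurable N (fun t => h t *: w t)%R.
Proof.
move=> hN mh wfin [phi [sphi wphi]].
have [g gh] := approximation_sfun measurable_halfline mh.
have lg n : simple_levels (g n).
  split => [|z]; first exact: (@fimfunP _ _ (g n)).
  apply: measurableI; first exact: measurable_halfline.
  exact: measurable_sfunP.
have th n : exists th : {fimfun R >-> Z},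
    (th : R -> Z) = (fun t => g n t *: phi n t)%R /\ simple_fun N th.
  have [||th thE sth] := @simple_fun_of N (fun t => g n t *: phi n t)%R.
  - apply: (@simple_levels2 _ _ _ _ (g n) (phi n) (fun c z => c *: z)%R) => //.
    exact: simple_fun_levels (sphi n).
  - move=> t t0; apply: (le_lt_trans (esn_leZ hN _ _)).
    by rewrite lte_mul_pinfty//; apply (sphi n).
  by exists th.
have [theta thetaE] := choice th.
exists theta; split => [n|]; first by have [] := thetaE n.
apply: filterS wphi => t wt Dt.
have t0 : (0 < t)%R by apply/halflineP.
have ht : `|(h t - g n t)%R%:E| @[n --> \oo] --> 0.
  apply/cvg_abse0P.
  rewrite -(subee (_ : (h t)%:E \is a fin_num))//.
  under eq_fun do rewrite EFinB.
  apply: cvgeB => //; first exact: cvg_cst.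
  exact: gh.
have pt := esn_cvg hN (wfin t t0) (wt Dt).
have c1 : `|h t|%:E * N (w t - phi n t)%R @[n --> \oo] --> 0.
  rewrite -[X in _ --> X](mule0 `|h t|%:E); apply: cvgeZl => //; exact: wt.
have c2 : `|(h t - g n t)%R%:E| * N (phi n t) @[n --> \oo] --> 0.
  rewrite -[X in _ --> X](mul0e (N (w t))); apply: cvgeM => //.
  by rewrite mule_def_fin// ge0_fin_numE ?(esn_ge0 hN)// wfin.
have c12 : `|h t|%:E * N (w t - phi n t)%R +
    `|(h t - g n t)%R%:E| * N (phi n t) @[n --> \oo] --> 0.
  by rewrite -[X in _ --> X]adde0; exact: cvgeD.
apply: (squeeze_cvge _ (cvg_cst 0) c12).
apply: nearW => n; rewrite (esn_ge0 hN)/= (proj1 (thetaE n)).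
rewrite [X in N X](_ : _ = h t *: (w t - phi n t) + (h t - g n t) *: phi n t)%R.
  by apply: (le_trans (esn_leD hN _ _)); rewrite leeD// (esn_leZ hN).
by rewrite scalerBr scalerBl addrA subrK.
Qed.

Variables (N : Z -> \bar R) (G : Z -> R -> \bar R).
Hypothesis hN : ext_seminorm N.
Hypothesis hG : forall t, (0 < t)%R -> ext_seminorm (G ^~ t).
Hypothesis mG : forall z, measurable_fun D (G z : lebesgueR R -> \bar R).
Hypothesis GN : forall t, (0 < t)%R ->
  exists2 c : R, (0 <= c)%R & forall z, G z t <= c%:E * N z.

Lemma seminorm_cvg (v : nat -> Z) t : (0 < t)%R ->
  N (v n) @[n --> \oo] --> 0 -> G (v n) t @[n --> \oo] --> 0.
Proof.
move=> t0 v0; have [c c0 Gc] := GN t0.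
have cv : c%:E * N (v n) @[n --> \oo] --> 0.
  by rewrite -[X in _ --> X](mule0 c%:E); exact: cvgeZl.
apply: (squeeze_cvge _ (cvg_cst 0) cv).
by apply: nearW => n; rewrite (esn_ge0 (hG t0))/=.
Qed.

(** Almost everywhere G (w t) t is the limit of G (phi_n t) t for simple
    phi_n, each of which is measurable; completeness of the Lebesgue measure
    disposes of the exceptional null set. *)
Lemma measurable_fun_seminorm (w : R -> Z) :
  (forall t, (0 < t)%R -> N (w t) < +oo) -> strongly_measurable N w ->
  measurable_fun D ((fun t => G (w t) t) : lebesgueR R -> \bar R).
Proof.
move=> wfin [phi [sphi wphi]].
have mphi n :
    measurable_fun D ((fun t => G (phi n t) t) : lebesgueR R -> \bar R).
  apply: (@measurable_fun_levels _ _ (phi n) G) => //.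
  exact: simple_fun_levels (sphi n).
have cphi : {ae leb R, forall t : lebesgueR R, D t ->
    G (phi n t) t @[n --> \oo] --> G (w t) t}.
  apply: filterS wphi => t wt Dt; have t0 : (0 < t)%R by apply/halflineP.
  have [c c0 Gc] := GN t0.
  apply: (esn_cvg (hG t0)); last exact: seminorm_cvg t0 (wt Dt).
  by apply: (le_lt_trans (Gc _)); rewrite lte_mul_pinfty//; exact: wfin.
apply: (ae_measurable_fun (@completed_lebesgue_measure_is_complete R)
  (f := fun t => limn_esup (fun n => G (phi n t) t))).
  apply: filterS cphi => t /[apply] ct.
  by rewrite limn_esup_lim; apply/cvg_lim => //; exact: cvg_esups.
by apply: measurable_fun_limn_esup.
Qed.

(** Replacing phi_k by 0 wherever 0 approximates w better makes G (w, .)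
    itself a dominating function, without spoiling convergence; cutting off
    at k.+1 makes the supports of finite measure. *)
Lemma simple_fun_dense (w : R -> Z) (eps : R) :
  (forall t, (0 < t)%R -> N (w t) < +oo) -> strongly_measurable N w ->
  \int[leb R]_(t in halfline R) G (w t) t < +oo -> (0 < eps)%R ->
  exists2 psi : {fimfun R >-> Z}, integrable_simple_fun N psi &
    \int[leb R]_(t in halfline R) G (w t - psi t)%R t < eps%:E.
Proof.
move=> wfin mw intw eps0; have [phi [sphi wphi]] := mw.
have mD := @measurable_halfline R.
have wphiB k : forall t, (0 < t)%R -> N (w t - phi k t)%R < +oo.
  move=> t t0; apply: (le_lt_trans (esn_leB hN _ _)).
  by rewrite lte_add_pinfty ?wfin//; apply (sphi k).
pose b k t := (t <= k.+1%:R)%R && (G (w t - phi k t)%R t <= G (w t) t).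
have mb k : simple_levels (b k).
  apply: simple_levels_bool.
  rewrite (_ : _ `&` _ = `]0%R, k.+1%:R]%classic `&`
    (D `&` [set t | G (w t - phi k t)%R t <= G (w t) t])); last first.
    apply/seteqP; split => t /=; rewrite in_itv/=.
      by move=> [Dt /andP[-> ?]]; have /halflineP-> := Dt.
    by move=> [/andP[t0 tk] [Dt ?]]; split => //; rewrite /b tk.
  apply: measurableI.
    by apply: borel_lebesgue_measurable; exact: measurable_itv.
  apply: measurable_lee => //; last exact: measurable_fun_seminorm.
  apply: (@measurable_fun_seminorm (fun t => w t - phi k t)%R).
    exact: wphiB.
  exact: strongly_measurableB hN mw (strongly_measurable_simple hN (sphi k)).
have ex_psi k : exists psi : {fimfun R >-> Z},
    (psi : R -> Z) = (fun t => if b k t then phi k t else 0%R) /\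
    integrable_simple_fun N psi.
  have [||psi psiE spsi] :=
      @simple_fun_of N (fun t => if b k t then phi k t else 0%R).
  - apply: (@simple_levels2 _ _ _ _ (phi k) (b k)
      (fun z (c : bool) => if c then z else 0%R)) => //.
    exact: simple_fun_levels (sphi k).
  - move=> t t0; case: ifPn => _; first by apply (sphi k).
    by rewrite (esn0 hN).
  exists psi; split => //; split => // z z0.
  have mk : measurable (`]0%R, k.+1%:R]%classic : set (lebesgueR R)).
    by apply: borel_lebesgue_measurable; exact: measurable_itv.
  apply: (@le_lt_trans _ _ (leb R `]0%R, k.+1%:R]%classic)).
    rewrite le_measure ?inE//; first by case: spsi.
    move=> t [/halflineP t0]; rewrite /preimage/= psiE in_itv/= t0/= => zE.
    by move: zE z0; rewrite /b; case: ltP => //= _ <-; rewrite eqxx.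
  rewrite [X in X < _](_ : _ =
    lebesgue_measure (`]0%R, k.+1%:R]%classic : set R))//.
  by rewrite lebesgue_measure_itv/=; case: ifP; rewrite ?ltry// -EFinB ltry.
have [psi psiE] := choice ex_psi.
have spsi k : simple_fun N (psi k) by have [_ []] := psiE k.
pose f k t := G (w t - psi k t)%R t.
have mf k : measurable_fun D (f k : lebesgueR R -> \bar R).
  apply: (@measurable_fun_seminorm (fun t => w t - psi k t)%R).
    move=> t t0; apply: (le_lt_trans (esn_leB hN _ _)).
    by rewrite lte_add_pinfty ?wfin//; apply (spsi k).
  exact: strongly_measurableB hN mw (strongly_measurable_simple hN (spsi k)).
have fW k t : f k t <= G (w t) t.
  rewrite /f (proj1 (psiE k)); case: ifPn; rewrite ?subr0// /b.
  by move=> /andP[].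
have f0 k t : D t -> 0 <= f k t.
  by move=> /halflineP t0; exact: esn_ge0 (hG t0) _.
have cf : {ae leb R, forall t : lebesgueR R, D t -> f k t @[k --> \oo] --> 0}.
  apply: filterS wphi => t wt Dt; have t0 : (0 < t)%R by apply/halflineP.
  apply: (squeeze_cvge _ (cvg_cst 0) (seminorm_cvg t0 (wt Dt))).
  near=> k; rewrite f0//= /f (proj1 (psiE k)) /b.
  have -> /= : (t <= k.+1%:R)%R.
    apply: (@le_trans _ _ (k%:R)%R); last by rewrite ler_nat.
    by near: k; exact: nbhs_infty_ger.
  by case: ifPn => // nle; rewrite subr0 ltW// ltNge.
have W0 t : D t -> 0 <= G (w t) t.
  by move=> /halflineP t0; exact: esn_ge0 (hG t0) _.
have [|||_ _] := @dominated_convergence _ _ _ (leb R) D mD f (cst 0)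
    (fun t => G (w t) t) mf _ cf.
- exact: measurable_cst.
- apply/integrableP; split; first exact: measurable_fun_seminorm.
  by under eq_integral => t /set_mem Dt do rewrite gee0_abs ?W0//.
- by apply: aeW => t n Dt; rewrite gee0_abs ?f0.
rewrite integral0 => cint.
have : \forall k \near \oo, \int[leb R]_(t in D) f k t < eps%:E.
  move/fine_cvgP: cint => [cfin /cvgr_lt/(_ _ eps0) clt].
  by apply: filterS2 cfin clt => k kfin klt; move: klt; rewrite -lte_fin fineK.
by move=> [k _ /(_ k (leqnn k)) fk]; exists (psi k) => //; apply (psiE k).
Unshelve. all: by end_near. Qed.

End strong_measurability.

(** * Bochner integrals and simple functions *)

Section bochner.
Context {R : realType} {Z : lmodType R} (N : Z -> \bar R).
Hypothesis hN : ext_seminorm N.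
Local Open Scope ereal_scope.

Lemma eq_strongly_measurable (v w : R -> Z) :
  (forall t, (0 < t)%R -> v t = w t) ->
  strongly_measurable N v -> strongly_measurable N w.
Proof.
move=> vw [phi [sphi vphi]]; exists phi; split => //.
by apply: filterS vphi => t + Dt => /(_ Dt); rewrite vw//; exact/halflineP.
Qed.

Lemma eq_L1norm (g h : R -> \bar R) :
  (forall t, (0 < t)%R -> g t = h t) -> L1norm g = L1norm h.
Proof.
move=> gh; apply: eq_integral => t /set_mem Dt.
by rewrite gh//; exact/halflineP.
Qed.

Lemma eq_bochner_integral (v w : R -> Z) f :
  (forall t, (0 < t)%R -> v t = w t) ->
  is_bochner_integral N v f -> is_bochner_integral N w f.
Proof.
move=> vw [mv [phi [iphi vphi fphi]]]; split.
  exact: eq_strongly_measurable mv.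
exists phi; split => //; apply: cvg_trans vphi.
apply: near_eq_cvg; apply: nearW => n.
by apply: eq_L1norm => t t0; rewrite vw.
Qed.

Lemma bochner_integral_simple (psi : {fimfun R >-> Z}) :
  integrable_simple_fun N psi ->
  is_bochner_integral N psi (simple_integral psi).
Proof.
move=> ipsi; split; first exact: strongly_measurable_simple hN (proj1 ipsi).
exists (fun=> psi); split => //.
  have L0 : L1norm (fun t => N (psi t - psi t)%R) = 0.
    rewrite (@eq_L1norm _ (cst 0)); last by move=> t _; rewrite subrr (esn0 hN).
    by rewrite /L1norm; under eq_integral do rewrite abse0; rewrite integral0.
  by under eq_fun do rewrite L0; exact: cvg_cst.
by under eq_fun do rewrite subrr (esn0 hN); exact: cvg_cst.
Qed.

Lemma integrable_simple_support (phi : {fimfun R >-> Z}) :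
  integrable_simple_fun N phi ->
  leb R (halfline R `&` phi @^-1` [set~ 0%R]) < +oo.
Proof.
move=> [[_ mphi] iphi].
rewrite (_ : _ `&` _ = \bigcup_(z in range phi `&` [set~ 0%R])
    (halfline R `&` phi @^-1` [set z])); last first.
  apply/seteqP; split => [t [Dt pt]|t [z [_ z0] [Dt tz]]].
    by exists (phi t) => //; split => //; exists t.
  by split => //; rewrite /preimage/= tz.
have fI : finite_set (range phi `&` [set~ 0%R]) by exact: finite_setIl.
rewrite measure_fin_bigcup//; last by move=> x y _ _ [t [[_ <-] [_ <-]]].
rewrite fsbig_finite//= big_seq; apply: lte_sum_pinfty => z.
by rewrite in_fset_set// => /set_mem[_ /= /eqP]; exact: iphi.
Qed.

(** A level set of the difference at a nonzero value may meet infinitely large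
    level sets of phi or psi at 0, but no point lies in both: it is contained
    in the union of the two supports, whose measures are finite. *)
Lemma integrable_simple_funB (phi psi : {fimfun R >-> Z}) :
  integrable_simple_fun N phi -> integrable_simple_fun N psi ->
  exists2 theta : {fimfun R >-> Z},
    (theta : R -> Z) = (fun t => phi t - psi t)%R &
    integrable_simple_fun N theta.
Proof.
move=> iphi ipsi; have [[sphi _] [spsi _]] := (iphi, ipsi).
have [||th thE sth] := @simple_fun_of _ _ N (fun t => phi t - psi t)%R.
- apply: (@simple_levels2 _ _ _ _ phi psi (fun x y => x - y)%R).
    exact: simple_fun_levels sphi.
  exact: simple_fun_levels spsi.
- move=> t t0; apply: (le_lt_trans (esn_leB hN _ _)).
  by rewrite lte_add_pinfty//; [apply sphi|apply spsi].
exists th => //; split => // z z0.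
have mS (g : {fimfun R >-> Z}) : simple_fun N g ->
    measurable (halfline R `&` g @^-1` [set~ 0%R] : set (lebesgueR R)).
  by move=> /simple_fun_levels; exact: measurable_levels_preimage.
apply: le_lt_trans (lte_add_pinfty (integrable_simple_support iphi)
  (integrable_simple_support ipsi)).
apply: le_trans (measureU2 _ (mS _ sphi) (mS _ spsi)).
rewrite le_measure ?inE//; first by case: sth.
  by apply: measurableU; exact: mS.
move=> t [Dt]; rewrite /preimage/= thE => tz.
have [phi0|phi0] := eqVneq (phi t) 0%R; [right|left]; split => //=.
  by move=> psi0; move: z0; rewrite -tz phi0 psi0 subr0 eqxx.
exact/eqP.
Qed.

(** If phi_n approximates v then phi_n - psi approximates v - psi, with exactly
    the same errors. *)
Lemma bochner_integralB_simple (v : R -> Z) f (psi : {fimfun R >-> Z}) :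
  is_bochner_integral N v f -> integrable_simple_fun N psi ->
  is_bochner_integral N (fun t => v t - psi t)%R (f - simple_integral psi)%R.
Proof.
move=> [mv [phi [iphi vphi fphi]]] ipsi; split.
  apply: strongly_measurableB => //.
  exact: strongly_measurable_simple hN (proj1 ipsi).
have th n : exists th : {fimfun R >-> Z},
    (th : R -> Z) = (fun t => phi n t - psi t)%R /\ integrable_simple_fun N th.
  by have [th thE ith] := integrable_simple_funB (iphi n) ipsi; exists th.
have [theta thetaE] := choice th.
exists theta; split.
- by move=> n; case: (thetaE n).
- apply: cvg_trans vphi; apply: near_eq_cvg; apply: nearW => n.
  apply: eq_L1norm => t t0; rewrite (proj1 (thetaE n)).
  by rewrite opprB addrA subrK.
- apply: cvg_trans fphi; apply: near_eq_cvg; apply: nearW => n.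
  rewrite (@simple_integralB _ _ N N (phi n) psi (theta n))//.
    by rewrite opprB addrA subrK.
  by move=> t; rewrite (proj1 (thetaE n)).
Qed.

End bochner.

(** * The norms of a compatible couple *)

Section couple_norms.
Context {R : realType} {X0 X1 : completeNormedModType R}.
Context {Z : topologicalLmodType R}.
Variables (i0 : {linear X0 -> Z}) (i1 : {linear X1 -> Z}).
Local Open Scope ereal_scope.

Section embedded.
Context {X : completeNormedModType R} (i : {linear X -> Z}).

Lemma embedded_norm_ltyP z : embedded_norm i z < +oo <-> range i z.
Proof.
split; first by move=> /ereal_inf_ltP[_ [x xz _] _]; exists x.
move=> [x _ xz]; apply/ereal_inf_ltP; exists `|x|%:E; last by rewrite ltry.
by exists x.
Qed.

Hypothesis inj_i : injective i.

Lemma embedded_normE x : embedded_norm i (i x) = `|x|%:E.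
Proof.
rewrite /embedded_norm (_ : [set _ | _ in _] = [set `|x|%:E]) ?ereal_inf1//.
by apply/seteqP; split => [_ [y /= /inj_i -> <-]//|_ ->]; exists x.
Qed.

Lemma embedded_norm_ge0 z : 0 <= embedded_norm i z.
Proof. by apply: le_ereal_inf_tmp => _ [x _ <-]; rewrite lee_fin. Qed.

Lemma embedded_norm_seminorm : ext_seminorm (embedded_norm i).
Proof.
split; first exact: embedded_norm_ge0.
- move=> x y; have [xoo|] := eqVneq (embedded_norm i x) +oo.
    by rewrite xoo addye ?leey// -ltNye (lt_le_trans _ (embedded_norm_ge0 _)).
  rewrite -ltey => /embedded_norm_ltyP[x' _ <-].
  have [yoo|] := eqVneq (embedded_norm i y) +oo.
    by rewrite yoo addey ?leey// -ltNye (lt_le_trans _ (embedded_norm_ge0 _)).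
  rewrite -ltey => /embedded_norm_ltyP[y' _ <-].
  by rewrite -linearD !embedded_normE -EFinD lee_fin ler_normD.
- move=> c z; have [->|c0] := eqVneq c 0%R.
    by rewrite scale0r normr0 mul0e -(linear0 i) embedded_normE normr0.
  have [zoo|] := eqVneq (embedded_norm i z) +oo.
    by rewrite zoo gt0_muley ?leey// lte_fin normr_gt0.
  rewrite -ltey => /embedded_norm_ltyP[z' _ <-].
  by rewrite -linearZ !embedded_normE -EFinM lee_fin normrZ.
Qed.

End embedded.

Hypotheses (inj0 : injective i0) (inj1 : injective i1).
Let s0 := embedded_norm_seminorm inj0.
Let s1 := embedded_norm_seminorm inj1.

Lemma J_functional_seminorm t : (0 <= t)%R ->
  ext_seminorm (fun z => J_functional i0 i1 z t).
Proof.
move=> t0; split => [z|x y|c z]; rewrite /J_functional.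
- by rewrite le_max (esn_ge0 s0).
- rewrite ge_max; apply/andP; split.
    by apply: (le_trans (esn_leD s0 _ _)); rewrite leeD// le_max lexx.
  apply: (@le_trans _ _ (t%:E * (embedded_norm i1 x + embedded_norm i1 y))).
    by rewrite lee_wpmul2l ?lee_fin// (esn_leD s1).
  rewrite ge0_muleDr ?(esn_ge0 s1)//.
  by rewrite leeD// le_max lexx orbT.
- rewrite ge_max; apply/andP; split.
    apply: (le_trans (esn_leZ s0 _ _)); rewrite lee_wpmul2l ?lee_fin//.
    by rewrite le_max lexx.
  apply: (@le_trans _ _ (t%:E * (`|c|%:E * embedded_norm i1 z))).
    by rewrite lee_wpmul2l ?lee_fin// (esn_leZ s1).
  rewrite muleCA lee_wpmul2l ?lee_fin//.
  by rewrite le_max lexx orbT.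
Qed.

Lemma cap_normE z : cap_norm i0 i1 z = J_functional i0 i1 z 1.
Proof. by rewrite /J_functional mul1e. Qed.

Lemma cap_norm_seminorm : ext_seminorm (cap_norm i0 i1).
Proof.
rewrite (_ : cap_norm i0 i1 = fun z => J_functional i0 i1 z 1).
  exact: J_functional_seminorm.
by apply/funext => z; exact: cap_normE.
Qed.

Lemma cap_norm_ltyP z : cap_norm i0 i1 z < +oo <-> couple_cap i0 i1 z.
Proof.
rewrite /cap_norm gt_max; split.
  by move=> /andP[/embedded_norm_ltyP ? /embedded_norm_ltyP ?].
by move=> [? ?]; apply/andP; split; apply/embedded_norm_ltyP.
Qed.

Lemma couple_cap0 : couple_cap i0 i1 0%R.
Proof. by apply/cap_norm_ltyP; rewrite (esn0 cap_norm_seminorm). Qed.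

Lemma couple_capB x y :
  couple_cap i0 i1 x -> couple_cap i0 i1 y -> couple_cap i0 i1 (x - y)%R.
Proof.
move=> /cap_norm_ltyP xc /cap_norm_ltyP yc; apply/cap_norm_ltyP.
by apply: le_lt_trans (esn_leB cap_norm_seminorm x y) _; rewrite lte_add_pinfty.
Qed.

Lemma couple_capD x y :
  couple_cap i0 i1 x -> couple_cap i0 i1 y -> couple_cap i0 i1 (x + y)%R.
Proof.
move=> /cap_norm_ltyP xc /cap_norm_ltyP yc; apply/cap_norm_ltyP.
by apply: le_lt_trans (esn_leD cap_norm_seminorm x y) _; rewrite lte_add_pinfty.
Qed.

Lemma couple_capZ c x : couple_cap i0 i1 x -> couple_cap i0 i1 (c *: x)%R.
Proof.
move=> /cap_norm_ltyP xc; apply/cap_norm_ltyP.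
by apply: le_lt_trans (esn_leZ cap_norm_seminorm c x) _; rewrite lte_mul_pinfty.
Qed.

Lemma J_functional_le_cap t z : (0 <= t)%R ->
  J_functional i0 i1 z t <= (Num.max 1 t)%:E * cap_norm i0 i1 z.
Proof.
move=> t0; have c0 := esn_ge0 cap_norm_seminorm z.
have h r : (0 <= r <= Num.max 1 t)%R ->
    forall y, y <= cap_norm i0 i1 z ->
    r%:E * y <= (Num.max 1 t)%:E * cap_norm i0 i1 z.
  move=> /andP[r0 rt] y yz; apply: (@le_trans _ _ (r%:E * cap_norm i0 i1 z)).
    by rewrite lee_wpmul2l ?lee_fin.
  by rewrite lee_wpmul2r// lee_fin.
rewrite /J_functional ge_max -[X in (X <= _) && _]mul1e !h//.
- by rewrite t0 le_max lexx orbT.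
- by rewrite /cap_norm le_max lexx orbT.
- by rewrite ler01 le_max lexx.
- by rewrite /cap_norm le_max lexx.
Qed.

Lemma sum_norm_ge0 z : 0 <= sum_norm i0 i1 z.
Proof.
apply: le_ereal_inf_tmp => _ [z0 [z1 [_ ->]]].
by rewrite adde_ge0 ?(esn_ge0 s0) ?(esn_ge0 s1).
Qed.

Lemma sum_norm_le z0 z1 :
  sum_norm i0 i1 (z0 + z1)%R <= embedded_norm i0 z0 + embedded_norm i1 z1.
Proof. by apply: ereal_inf_lbound; exists z0, z1. Qed.

Lemma sum_norm_le_cap z : sum_norm i0 i1 z <= cap_norm i0 i1 z.
Proof.
have := sum_norm_le z 0; rewrite addr0 (esn0 s1) adde0 => /le_trans; apply.
by rewrite /cap_norm le_max lexx.
Qed.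

Lemma sum_norm_seminorm : ext_seminorm (sum_norm i0 i1).
Proof.
split; first exact: sum_norm_ge0.
- move=> x y; have [xoo|] := eqVneq (sum_norm i0 i1 x) +oo.
    by rewrite xoo addye ?leey// -ltNye (lt_le_trans _ (sum_norm_ge0 _)).
  rewrite -ltey => xoo; have [yoo|] := eqVneq (sum_norm i0 i1 y) +oo.
    by rewrite yoo addey ?leey// -ltNye (lt_le_trans _ (sum_norm_ge0 _)).
  rewrite -ltey => yoo; apply/lee_addgt0Pr => e e0.
  have e20 : (0 < e / 2)%R by rewrite divr_gt0.
  have xf : sum_norm i0 i1 x \is a fin_num.
    by rewrite ge0_fin_numE ?sum_norm_ge0.
  have yf : sum_norm i0 i1 y \is a fin_num.
    by rewrite ge0_fin_numE ?sum_norm_ge0.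
  have [_ [x0 [x1 [xE ->]]] xlt] := lb_ereal_inf_adherent e20 xf.
  have [_ [y0 [y1 [yE ->]]] ylt] := lb_ereal_inf_adherent e20 yf.
  rewrite [in leLHS]xE [in leLHS]yE addrACA.
  apply: (le_trans (sum_norm_le _ _)).
  apply: (le_trans (leeD (esn_leD s0 _ _) (esn_leD s1 _ _))).
  rewrite addeACA; apply: (le_trans (leeD (ltW xlt) (ltW ylt))).
  by rewrite addeACA -EFinD -splitr.
- move=> c z; have [->|c0] := eqVneq c 0%R.
    rewrite scale0r normr0 mul0e; apply: (le_trans (sum_norm_le_cap _)).
    by rewrite (esn0 cap_norm_seminorm).
  have c0' : (0 < `|c|)%R by rewrite normr_gt0.
  rewrite [in leRHS]/sum_norm -ereal_inf_pZl//.
  apply: le_ereal_inf_tmp => _ [_ [z0 [z1 [-> ->]]] <-].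
  rewrite scalerDr; apply: (le_trans (sum_norm_le _ _)).
  rewrite ge0_muleDr ?(esn_ge0 s0) ?(esn_ge0 s1)//.
  by rewrite leeD ?(esn_leZ s0) ?(esn_leZ s1).
Qed.

End couple_norms.

(** * Density of the intersection *)

Section J_space_density.
Context {R : realType} {X0 X1 : completeNormedModType R}.
Context {Z : topologicalLmodType R}.
Variables (i0 : {linear X0 -> Z}) (i1 : {linear X1 -> Z}).
Hypotheses (inj0 : injective i0) (inj1 : injective i1).
Variable a : R -> R.
Hypothesis a_ge0 : forall t, 0 < t -> 0 <= a t.
Hypothesis ma : leb_measurable_fun a.
Notation D := (halfline R : set (lebesgueR R)).
Notation cap := (cap_norm i0 i1).
Notation J := (J_functional i0 i1).
Local Open Scope ereal_scope.

Let hcap : ext_seminorm cap := cap_norm_seminorm inj0 inj1.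
Let hsum : ext_seminorm (sum_norm i0 i1) := sum_norm_seminorm inj0 inj1.
Let hJ (t : R) (t0 : (0 <= t)%R) : ext_seminorm (fun z => J z t) :=
  J_functional_seminorm inj0 inj1 t0.

Let wJ (z : Z) (t : R) : \bar R := (a t)%:E * J z t.

Lemma weighted_J_seminorm (t : R) : (0 < t)%R -> ext_seminorm (wJ ^~ t).
Proof.
move=> t0; have h := hJ (ltW t0); have at0 := a_ge0 t0.
split => [z|x y|c z]; rewrite /wJ.
- by rewrite mule_ge0 ?lee_fin// (esn_ge0 h).
- rewrite -ge0_muleDr ?(esn_ge0 h)// lee_wpmul2l ?lee_fin//.
  exact: esn_leD h _ _.
- rewrite muleCA lee_wpmul2l ?lee_fin//; exact: esn_leZ h _ _.
Qed.

Lemma measurable_weighted_J (z : Z) :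
  measurable_fun D (wJ z : lebesgueR R -> \bar R).
Proof.
apply: emeasurable_funM; first by apply/measurable_EFinP; exact: ma.
apply: measurable_maxe; first exact: measurable_cst.
apply: emeasurable_funM; last exact: measurable_cst.
by apply: (measurable_fun_borel_lebesgue (f := id)); exact: measurable_id.
Qed.

Lemma weighted_J_le_cap (t : R) : (0 < t)%R ->
  exists2 c : R, (0 <= c)%R & forall z, wJ z t <= c%:E * cap z.
Proof.
move=> t0; exists (a t * Num.max 1 t)%R.
  by rewrite mulr_ge0 ?a_ge0// le_max ler01.
move=> z; rewrite EFinM -muleA lee_wpmul2l ?lee_fin ?a_ge0//.
by apply: J_functional_le_cap => //; exact: ltW.
Qed.

(** By homogeneity of J (., t) the factor t^-1 cancels when the representing
    function is written t * w t, w being the integrand of the Bochner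
    integral. *)
Lemma L1norm_weighted_J (w : R -> Z) :
  L1norm (fun t => (t^-1 * a t)%:E * J (t *: w t)%R t) =
  \int[leb R]_(t in halfline R) wJ (w t) t.
Proof.
apply: eq_integral => t /set_mem/halflineP t0.
have Gt : (t^-1 * a t)%:E * J (t *: w t)%R t = wJ (w t) t.
  rewrite (esnZ (hJ (ltW t0))) ?gt_eqF// gtr0_norm// muleA -EFinM.
  by rewrite mulrAC mulVf ?gt_eqF// mul1r.
by rewrite Gt gee0_abs// (esn_ge0 (weighted_J_seminorm t0)).
Qed.

(** A value taken only outside the half-line need not lie in the intersection,
    but its coefficient is the measure of the empty set. *)
Lemma couple_cap_simple_integral (psi : {fimfun R >-> Z}) :
  simple_fun cap psi -> couple_cap i0 i1 (simple_integral psi).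
Proof.
move=> [fpsi mpsi]; rewrite /simple_integral fsbig_finite//=.
apply: (big_ind (couple_cap i0 i1)); first exact: (couple_cap0 inj0 inj1).
  exact: (couple_capD inj0 inj1).
move=> z _; have [z0|/set0P[t [/halflineP t0 <-]]] :=
    eqVneq (halfline R `&` psi @^-1` [set z]) set0.
  by rewrite z0 measure0 scale0r; exact: (couple_cap0 inj0 inj1).
by apply: (couple_capZ inj0 inj1); apply/cap_norm_ltyP; exact: fpsi.
Qed.

Lemma integrable_simple_sum (psi : {fimfun R >-> Z}) :
  integrable_simple_fun cap psi -> integrable_simple_fun (sum_norm i0 i1) psi.
Proof.
move=> [[fpsi mpsi] ipsi]; split => //; split => // t t0.
exact: le_lt_trans (sum_norm_le_cap i0 inj1 _) (fpsi t t0).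
Qed.

Lemma strongly_measurable_mulid (w : R -> Z) :
  (forall t, (0 < t)%R -> cap (w t) < +oo) -> strongly_measurable cap w ->
  strongly_measurable cap (fun t => t *: w t)%R.
Proof.
move=> wfin mw; apply: (@strongly_measurableZ _ _ cap id) => //.
by apply: (measurable_fun_borel_lebesgue (f := id)); exact: measurable_id.
Qed.

Lemma strongly_measurable_mulinv (w : R -> Z) :
  (forall t, (0 < t)%R -> cap (w t) < +oo) -> strongly_measurable cap w ->
  strongly_measurable cap (fun t => t^-1 *: w t)%R.
Proof.
move=> wfin mw.
(* On the half-line the inverse is the power of exponent -1, a function which
   is Borel measurable on the whole line. *)
apply: (eq_strongly_measurable (v := fun t => t `^ (-1) *: w t)%R).
  by move=> t t0; rewrite powR_inv1// ltW.
apply: (@strongly_measurableZ _ _ cap (fun t => t `^ (-1))%R) => //.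
by apply: measurable_fun_borel_lebesgue; exact: measurable_powR.
Qed.

Lemma J_representation_simple (psi : {fimfun R >-> Z}) :
  integrable_simple_fun cap psi ->
  J_representation i0 i1 (simple_integral psi) (fun t => t *: psi t)%R.
Proof.
move=> ipsi; have [[fpsi _] _] := ipsi; split.
- move=> t t0; apply: (couple_capZ inj0 inj1).
  by apply/cap_norm_ltyP; exact: fpsi.
- apply: strongly_measurable_mulid => //.
  exact: strongly_measurable_simple hcap (proj1 ipsi).
- apply: (eq_bochner_integral (v := psi)).
    by move=> t t0; rewrite scalerA mulVf ?gt_eqF// scale1r.
  by apply: bochner_integral_simple => //; exact: integrable_simple_sum.
Qed.

Lemma J_representationB_simple f u (psi : {fimfun R >-> Z}) :
  J_representation i0 i1 f u -> integrable_simple_fun cap psi ->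
  J_representation i0 i1 (f - simple_integral psi)%R
    (fun t => u t - t *: psi t)%R.
Proof.
move=> [ucap mu iu] ipsi; have [[fpsi _] _] := ipsi.
have [cpsi mpsi _] := J_representation_simple ipsi.
split.
- by move=> t t0; apply: (couple_capB inj0 inj1); [exact: ucap|exact: cpsi].
- exact: strongly_measurableB.
- have := bochner_integralB_simple hsum iu (integrable_simple_sum ipsi).
  apply: eq_bochner_integral => t t0.
  by rewrite scalerBr scalerA mulVf ?gt_eqF// scale1r.
Qed.

(** The density statement for a single representation: simple_fun_dense applied
    to w t := t^-1 u t and the weighted seminorms a t * J (., t). *)
Lemma J_representation_approx f u (eps : R) :
  J_representation i0 i1 f u ->
  L1norm (fun t => (t^-1 * a t)%:E * J (u t) t) < +oo -> (0 < eps)%R ->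
  exists2 g, couple_cap i0 i1 g & J_norm i0 i1 a (f - g)%R < eps%:E.
Proof.
move=> fu; have [ucap mu iu] := fu => intu eps0.
pose w t := (t^-1 *: u t)%R.
have uw t : (0 < t)%R -> u t = (t *: w t)%R.
  by move=> t0; rewrite /w scalerA mulfV ?gt_eqF// scale1r.
have ufin t : (0 < t)%R -> cap (u t) < +oo.
  by move=> t0; apply/cap_norm_ltyP; exact: ucap.
have wfin t : (0 < t)%R -> cap (w t) < +oo.
  move=> t0; apply/cap_norm_ltyP.
  by apply: (couple_capZ inj0 inj1); exact: ucap.
have mw : strongly_measurable cap w by exact: strongly_measurable_mulinv.
have intw : \int[leb R]_(t in halfline R) wJ (w t) t < +oo.
  rewrite -L1norm_weighted_J; apply: le_lt_trans intu.
  by rewrite (@eq_L1norm _ _ (fun t => (t^-1 * a t)%:E * J (u t) t))// => t t0;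
    rewrite -uw.
have [psi ipsi small] := simple_fun_dense hcap weighted_J_seminorm
  measurable_weighted_J weighted_J_le_cap wfin mw intw eps0.
exists (simple_integral psi).
  exact: couple_cap_simple_integral (proj1 ipsi).
apply: le_lt_trans small; rewrite -L1norm_weighted_J.
rewrite (@eq_L1norm _ _ (fun t => (t^-1 * a t)%:E * J (u t - t *: psi t)%R t)).
  apply: ereal_inf_lbound; exists (fun t => u t - t *: psi t)%R => //.
  exact: J_representationB_simple.
by move=> t t0; rewrite scalerBr -uw.
Qed.

(** On [1, 2[ the functional J (g, t) is at most twice the intersection norm of
    g, so t g restricted to [1, 2[ has weighted norm at most 2 M times that
    norm; as [1, 2[ has measure 1, it represents g. *)
Lemma couple_cap_sub_J_space (M : R) :
  (forall t, (1 <= t)%R -> (t < 2)%R -> (a t <= M)%R) ->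
  couple_cap i0 i1 `<=` J_space i0 i1 a.
Proof.
move=> aM g gcap; have gfin : cap g < +oo by apply/cap_norm_ltyP.
pose A : set R := `[1%R, 2%R[%classic.
have AD : A `<=` halfline R.
  move=> t; rewrite /A/= in_itv/= => /andP[t1 _]; apply/halflineP.
  exact: lt_le_trans t1.
have mA : measurable (A : set (lebesgueR R)).
  by apply: borel_lebesgue_measurable; exact: measurable_itv.
have lA : leb R A = 1.
  rewrite [LHS](_ : _ = lebesgue_measure A)// lebesgue_measure_itv/=.
  by rewrite lte_fin ltr1n -EFinB -[2%R]/(1 + 1)%R addrK.
pose b (t : R) := t \in A.
have lb : simple_levels b.
  apply: simple_levels_bool; rewrite set_mem_set; apply: measurableI => //.
  exact: measurable_halfline.
have [||psi psiE spsi] :=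
    @simple_fun_of _ _ cap (fun t => if b t then g else 0%R).
- exact: (@simple_levels2 _ _ _ _ b b (fun c _ => if c then g else 0%R)).
- by move=> t _; case: ifP; rewrite ?(esn0 hcap).
have ipsi : integrable_simple_fun cap psi.
  split => // z z0; apply: (@le_lt_trans _ _ (leb R A));
    last by rewrite lA ltry.
  rewrite le_measure ?inE//; first by case: spsi.
  move=> t [_]; rewrite /preimage/= psiE; case: ifPn => [/set_mem//|_ zE].
  by rewrite -zE eqxx in z0.
have ->: g = simple_integral psi.
  rewrite (@simple_integral_indic _ _ A g)//.
  - by rewrite lA scale1r.
  - by rewrite lA ltry.
  - by move=> t; rewrite psiE.
have rep := J_representation_simple ipsi.
have M0 : (0 <= M)%R.
  by apply: le_trans (aM 1%R _ _); rewrite ?a_ge0// ltr1n.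
split; last 2 first.
- by exists (fun t => t *: psi t)%R.
- apply: (@le_lt_trans _ _ (\int[leb R]_(t in halfline R) wJ (psi t) t)).
    rewrite -L1norm_weighted_J; apply: ereal_inf_lbound.
    by exists (fun t => t *: psi t)%R.
  pose C := (M * 2 * fine (cap g))%R.
  have C0 : (0 <= C)%R by rewrite !mulr_ge0// fine_ge0// (esn_ge0 hcap).
  apply: (@le_lt_trans _ _
    (\int[leb R]_(t in halfline R) (C%:E * (\1_A t)%:E))).
    apply: ge0_le_integral.
    + exact: measurable_halfline.
    + by move=> t /halflineP t0; exact: esn_ge0 (weighted_J_seminorm t0) _.
    + apply: (@measurable_fun_levels _ _ psi wJ) => //.
        exact: simple_fun_levels spsi.
      exact: measurable_weighted_J.
    + apply: measurable_funeM; apply/measurable_EFinP.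
      exact: measurable_indic.
    + move=> t /halflineP t0; rewrite psiE indicE /b.
      case: ifPn => tA; last first.
        by rewrite mule0 (esn0 (weighted_J_seminorm t0)).
      rewrite mule1 /C EFinM fineK ?ge0_fin_numE ?(esn_ge0 hcap)//.
      rewrite EFinM -muleA /wJ.
      move: tA; rewrite inE /A/= in_itv/= => /andP[t1 t2].
      apply: lee_pmul; rewrite ?lee_fin ?a_ge0 ?aM ?(esn_ge0 (hJ (ltW t0)))//.
      apply: (le_trans (J_functional_le_cap inj0 inj1 _ (ltW t0))).
      by rewrite lee_wpmul2r ?(esn_ge0 hcap)// lee_fin ge_max ler1n ltW.
  rewrite ge0_integralZl_EFin//.
  - rewrite integral_indic//; last exact: measurable_halfline.
    by rewrite setIidl// lA mule1 ltry.
  - exact: measurable_halfline.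
  - by apply/measurable_EFinP; exact: measurable_indic.
have [[x0 _ x0E] _] := couple_cap_simple_integral spsi.
by exists x0, 0%R; rewrite linear0 addr0.
Qed.

End J_space_density.

Theorem theorem1p23 (R : realType) (X0 X1 : completeNormedModType R)
    (Z : topologicalLmodType R) (i0 : {linear X0 -> Z}) (i1 : {linear X1 -> Z})
    (hX : compatible_couple i0 i1) (a : R -> R)
    (a_sv : slowly_varying a) (a_ac : abs_continuous_halfline a)
    (a_decr : decreasing_halfline a)
    (a_zero : a t @[t --> 0^'+] --> +oo)
    (a_infty : exists2 l : R, 0 < l & a t @[t --> +oo] --> l) :
  dense_in_J_space i0 i1 a (couple_cap i0 i1).
Proof.
have [_ [inj0 _] [inj1 _]] := hX; have [a_gt0 ma _] := a_sv.
have a_ge0 t : 0 < t -> 0 <= a t by move=> t0; exact/ltW/a_gt0.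
split.
  apply: (couple_cap_sub_J_space inj0 inj1 a_ge0 ma (M := a 1)) => t t1 _.
  by move: t1; rewrite le_eqVlt => /predU1P[<-//|t1]; exact/ltW/a_decr.
move=> f [_ _ /ereal_inf_ltP[_ [u fu <-] intu]] eps eps0.
exact: (J_representation_approx inj0 inj1 a_ge0 ma fu intu eps0).
Qed.
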